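(* (Subspace identification of the nonstationary latent variables.) Consider observed data generated by the latent-variable process described in the context. Assume: (A3.3.1, smooth and positive density) the density $p(\mathbf{z}^e_t\mid e_t)$ is smooth and positive over $\mathcal{Z}_t$ and $\mathcal{E}_t$; (A3.3.2, conditional independence) conditioned on $e_t$, the components $z^e_{t,i}$, $i\in\{1,\dots,n_e\}$, are mutually independent, i.e. $\log p(\mathbf{z}^e_t\mid e_t)=\sum_{i=1}^{n_e}\log p(z^e_{t,i}\mid e_t)$; (A3.3.3, linear independence) for any $\mathbf{z}^e_t\in\mathcal{Z}^e_t\subseteq\mathbb{R}^{n_e}$ there exist $n_e+1$ values of the environment, $e_j$ with $j=1,\dots,n_e+1$, such that the $n_e$ vectors $\mathbf{w}(\mathbf{z}^e_t,e_j)-\mathbf{w}(\mathbf{z}^e_t,e_0)$ are linearly independent, where $$\mathbf{w}(\mathbf{z}^e_t,e)=\left(\frac{\partial\log p(z^e_{t,1}\mid e)}{\partial z^e_{t,1}},\dots,\frac{\partial\log p(z^e_{t,n_e}\mid e)}{\partial z^e_{t,n_e}}\right).$$ Then, by learning the data generation process, $\mathbf{z}^e_t$ is subspace identifiable.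
   Context: Data generation process: $e_t\in\{1,\dots,E\}$ is a latent discrete environment forming a first-order Markov chain. The latent state is $\mathbf{z}_t=(\mathbf{z}^e_t,\mathbf{z}^s_t)\in\mathbb{R}^n$ with $\mathbf{z}^e_t=(z_{t,1},\dots,z_{t,n_e})$ nonstationary, $z^e_{t,i}=f^e_i(e_t,\epsilon^e_{t,i})$, and $\mathbf{z}^s_t=(z_{t,n_e+1},\dots,z_{t,n})\in\mathbb{R}^{n_s}$, $n_s=n-n_e$, stationary, $z^s_{t,i}=f^s_i(\mathbf{z}^s_{t-1},\epsilon^s_{t,i})$; noise terms are mutually independent and independent of past latents and environments. Observations are $\mathbf{x}_t=g(\mathbf{z}_t)$ with $g$ invertible. ''Learning the data generation process'' means fitting an estimated model of the same form (estimated latents $\hat{\mathbf{z}}_t=(\hat{\mathbf{z}}^e_t,\hat{\mathbf{z}}^s_t)$ with the same dimensions and the same conditional-independence structure given $\hat{\mathbf{z}}_{t-1}$ and $e_t$, invertible decoder $\hat g$) whose observational distribution matches the true one, so that $h=g^{-1}\circ\hat g$ is an invertible smooth map with $\mathbf{z}_t=h(\hat{\mathbf{z}}_t)$. Subspace identifiability of $\mathbf{z}^e_t$ means that for each true component $z^e_{t,i}$, $i\in\{1,\dots,n_e\}$, there exists a function $h_i$ with $z^e_{t,i}=h_i(\hat{\mathbf{z}}^e_t)$, i.e. the true nonstationary latents depend only on the estimated nonstationary latents. *)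

(* Defs.v *)
From HB Require Import structures.
From mathcomp Require Import all_boot all_order all_algebra.
From mathcomp Require Import all_classical all_reals all_analysis.
Set Implicit Arguments. Unset Strict Implicit. Unset Printing Implicit Defensive.
Import Order.TTheory GRing.Theory Num.Theory.
Import numFieldNormedType.Exports.
Local Open Scope classical_set_scope.
Local Open Scope ring_scope.

Section Defs.
Variable R : realType.

Fixpoint iterD (V W : normedModType R) (f : V -> W) (vs : seq V) : V -> W :=
  match vs with
  | [::] => f
  | v :: vs' => fun x => 'D_v (iterD f vs') x
  end.

Definition smooth (V W : normedModType R) (f : V -> W) : Prop :=
  forall (vs : seq V) (x : V), differentiable (iterD f vs) x.

Definition density1 (f : R -> R) : Prop :=
  [/\ (forall x, 0 <= f x), measurable_fun setT f &
      (\int[lebesgue_measure]_x (f x)%:E = 1)%E].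

(* w(z^e, e) = (d/dz_i log p(z^e_i | e))_i, from the marginal densities
   pm e i = p(z^e_{t,i} | e_t = e). *)
Definition wvec (E ne : nat) (pm : 'I_E -> 'I_ne -> R -> R)
    (ze : 'rV[R]_ne) (e : 'I_E) : 'rV[R]_ne :=
  \row_i (derive1 (fun y => ln (pm e i y)) (ze 0 i)).

End Defs.

(* Main.v *)
(* Write ze := lsubmx \o h for the true nonstationary latents as a function of
   the estimated ones.  Dividing the push-back identity for two environments e1
   and e2 cancels the stationary density and the Jacobian, so
   ln p(ze | e1) - ln p(ze | e2) depends on the estimated nonstationary block
   only.  Differentiating along a stationary direction v and using conditional
   independence gives sum_k (d_v ze)_k (w(ze, e1) - w(ze, e2))_k = 0 for all
   e1, e2; linear independence of these differences forces d_v ze = 0, and a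
   map whose differential kills every stationary direction does not depend on
   the stationary block. *)

Require Import Defs.
From HB Require Import structures.
From mathcomp Require Import all_boot all_order all_algebra.
From mathcomp Require Import all_classical all_reals all_analysis.
From mathcomp Require Import ring.
Set Implicit Arguments. Unset Strict Implicit.
Unset Printing Implicit Defensive.
Import Order.TTheory GRing.Theory Num.Theory.
Import numFieldNormedType.Exports.
Local Open Scope classical_set_scope.
Local Open Scope ring_scope.

Section RealLemmas.
Variable R : realType.

Lemma ln_prod (I : finType) (F : I -> R) :
  (forall i, 0 < F i) -> ln (\prod_i F i) = \sum_i ln (F i).
Proof.
move=> F_gt0.
suff [] : 0 < \prod_i F i /\ ln (\prod_i F i) = \sum_i ln (F i) by [].
elim/big_ind2 : _ => [|a1 b1 a2 b2 [a1_gt0 <-] [a2_gt0 <-]|i _] //.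
- by rewrite ln1.
- by rewrite mulr_gt0 // lnM ?posrE.
Qed.

Lemma prod_gt0_factor_gt0 n (f : 'I_n -> R -> R) :
  (forall i y, 0 <= f i y) -> (forall z : 'rV[R]_n, 0 < \prod_i f i (z 0 i)) ->
  forall i y, 0 < f i y.
Proof.
move=> f_ge0 prod_gt0 i y; rewrite lt0r f_ge0 andbT.
apply: contraTneq (prod_gt0 (const_mx y)) => fy0.
by rewrite (bigD1 i) //= mxE fy0 mul0r ltxx.
Qed.

(* No differentiability is needed: the two difference quotients coincide. *)
Lemma derive_sum_coord n (f : 'I_n -> R -> R) (z : 'rV[R]_n) i :
  'D_(delta_mx 0 i) (fun z : 'rV[R]_n => \sum_k f k (z 0 k)) z =
  derive1 (f i) (z 0 i).
Proof.
rewrite /derive /derive1; do 2 f_equal; apply: funext => t /=.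
congr (_ *: _); rewrite (bigD1 i) //= [X in _ - X](bigD1 i) //=.
rewrite !mxE !eqxx mulr1.
rewrite (eq_bigr (fun k => f k (z 0 k))); last first.
  by move=> k ki; rewrite !mxE (negbTE ki) mulr0 add0r.
by rewrite opprD addrACA subrr addr0.
Qed.

Lemma diff_row_expand n (W : normedModType R) (F : 'rV[R]_n -> W) z d :
  differentiable F z -> 'd F z d = \sum_k d 0 k *: 'D_(delta_mx 0 k) F z.
Proof.
move=> dF; rewrite {1}(row_sum_delta d) linear_sum; apply: eq_bigr => k _.
by rewrite linearZ /= deriveE.
Qed.

Lemma det_jacobian_neq0 n (h hinv : 'rV[R]_n -> 'rV[R]_n) :
  cancel h hinv -> cancel hinv h ->
  (forall x, differentiable h x) -> (forall x, differentiable hinv x) ->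
  forall x, \det ('J h x) != 0.
Proof.
move=> hK hinvK dh dhinv x.
have hhinv : h \o hinv = id by apply: funext => y; exact: hinvK.
have := diff_comp (dhinv (h x)) (dh (hinv (h x))); rewrite hK => d_hhinv.
have chain u : 'd h x ('d hinv (h x) u) = u.
  have d_comp : differentiable (h \o hinv) (h x).
    exact: differentiable_comp (dhinv _) (dh _).
  have := congr1 (fun f => f u) d_hhinv => /= <-.
  by rewrite -(deriveE _ d_comp) hhinv derive_id.
have J_mul : 'J hinv (h x) *m 'J h x = 1%:M.
  apply/row_matrixP => k; rewrite row_mul !rowE mulmx1.
  rewrite -(deriveEjacobian _ (dhinv _)) -(deriveEjacobian _ (dh _)).
  by rewrite !deriveE ?chain.
by have [_] := mulmx1_unit J_mul; rewrite unitmxE unitfE.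
Qed.

Lemma derive_cst_along (V W : normedModType R) (F : V -> W) x v :
  (forall t : R, F (t *: v + x) = F x) -> 'D_v F x = 0.
Proof.
move=> F_cst; rewrite /derive.
have -> : (fun t : R => t^-1 *: ((F \o shift x) (t *: v) - F x)) = fun=> 0.
  by apply: funext => t /=; rewrite F_cst subrr scaler0.
exact: lim_cst.
Qed.

Lemma diff_eq0_cst_along (V : normedModType R) (g : V -> R) (v : V) :
  (forall y, differentiable g y) -> (forall y, 'd g y v = 0) ->
  forall x, g (v + x) = g x.
Proof.
move=> dg dg_v0 x.
pose phi (t : R) := g (t *: v + x).
suff phi'0 t : is_derive t (1 : R) phi 0.
  by have := is_derive_0_is_cst 1 0 phi'0; rewrite /phi scale1r scale0r add0r.
have quot : (fun s : R => s^-1 *: ((phi \o shift t) (s *: 1) - phi t)) =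
    (fun s : R =>
       s^-1 *: ((g \o shift (t *: v + x)) (s *: v) - g (t *: v + x))).
  by apply: funext => s; rewrite /phi /= [s%:A]mulr1 scalerDl addrA.
split; rewrite /derivable ?/derive quot; first exact: diff_derivable.
by rewrite -/(derive g _ v) deriveE.
Qed.

Lemma lsubmx_determines m n k (f : 'rV[R]_(m + n) -> 'rV[R]_k) :
  (forall x, differentiable f x) ->
  (forall x v, lsubmx v = 0 -> 'd f x v = 0) ->
  forall x, f x = f (row_mx (lsubmx x) 0).
Proof.
move=> df df_l0 x; apply/rowP => j.
pose fj := (fun N : 'rV[R]_k => N 0 j) \o f.
have dcoord (M : 'rV[R]_k) : differentiable (fun N : 'rV[R]_k => N 0 j) M.
  exact: differentiable_coord.
have dfj y : differentiable fj y := differentiable_comp (df y) (dcoord _).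
have dfj_r0 y : 'd fj y (row_mx 0 (rsubmx x)) = 0.
  by rewrite diff_comp //= df_l0 ?row_mxKl ?linear0.
have := diff_eq0_cst_along dfj dfj_r0 (row_mx (lsubmx x) 0).
by rewrite /fj /= add_row_mx add0r addr0 hsubmxK.
Qed.

End RealLemmas.

Lemma row_free_mulmx_tr_eq0 (F : fieldType) n (A : 'M[F]_n) (d : 'rV[F]_n) :
  row_free A -> d *m A^T = 0 -> d = 0.
Proof.
rewrite row_free_unit -unitmx_tr => A_unit dA0.
by rewrite -(mulmxK A_unit d) dA0 mul0mx.
Qed.

Section NonstationaryBlock.
Variables (R : realType) (ne ns E : nat).
Variables (pe pe' : 'I_E -> 'rV[R]_ne -> R) (pm : 'I_E -> 'I_ne -> R -> R).
Variables (ps ps' : 'rV[R]_ns -> R) (h : 'rV[R]_(ne + ns) -> 'rV[R]_(ne + ns)).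

Hypothesis pe_diff : forall e z, differentiable (pe e) z.
Hypothesis pe_gt0 : forall e z, 0 < pe e z.
Hypothesis pm_ge0 : forall e i y, 0 <= pm e i y.
Hypothesis pe_prod : forall e z, pe e z = \prod_(i < ne) pm e i (z 0 i).
Hypothesis ps_gt0 : forall zs, 0 < ps zs.
Hypothesis h_diff : forall x, differentiable h x.
Hypothesis det_J_neq0 : forall x, \det ('J h x) != 0.
Hypothesis pushback : forall e x,
  pe' e (lsubmx x) * ps' (rsubmx x) =
  pe e (lsubmx (h x)) * ps (rsubmx (h x)) * `|\det ('J h x)|.
Hypothesis w_free : forall z : 'rV[R]_ne, exists es : 'I_ne.+1 -> 'I_E,
  row_free (\matrix_(j < ne)
    (wvec pm z (es (lift ord0 j)) - wvec pm z (es ord0))).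

Let ze : 'rV[R]_(ne + ns) -> 'rV[R]_ne := lsubmx \o h.
Let logp e : 'rV[R]_ne -> R := @ln R \o pe e.

Lemma density_ratio_lsubmx e1 e2 x :
  pe e1 (ze x) / pe e2 (ze x) = pe' e1 (lsubmx x) / pe' e2 (lsubmx x).
Proof.
have c_gt0 : 0 < ps (rsubmx (h x)) * `|\det ('J h x)|.
  by rewrite mulr_gt0 // normr_gt0.
have ps'_neq0 : ps' (rsubmx x) != 0.
  apply/eqP => ps'0; have := pushback e1 x.
  rewrite ps'0 mulr0 -mulrA => /esym/eqP.
  by rewrite mulf_eq0 (gt_eqF (pe_gt0 _ _)) (gt_eqF c_gt0).
have pe'E e : pe' e (lsubmx x) =
    pe e (ze x) * (ps (rsubmx (h x)) * `|\det ('J h x)|) / ps' (rsubmx x).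
  by rewrite mulrA -pushback mulfK.
rewrite !pe'E; field.
rewrite ps'_neq0 normr_eq0 det_J_neq0.
by rewrite (gt_eqF (ps_gt0 _)) (gt_eqF (pe_gt0 _ _)).
Qed.

Lemma pm_gt0 e i y : 0 < pm e i y.
Proof.
by apply: prod_gt0_factor_gt0 (pm_ge0 e) _ i y => z; rewrite -pe_prod.
Qed.

Lemma logp_differentiable e z : differentiable (logp e) z.
Proof.
apply: differentiable_comp (pe_diff e z) _; apply/derivable1_diffP.
exact/ex_derive/is_derive1_ln/pe_gt0.
Qed.

Lemma diff_logp e z d : 'd (logp e) z d = \sum_k d 0 k * wvec pm z e 0 k.
Proof.
rewrite diff_row_expand; last exact: logp_differentiable.
apply: eq_bigr => k _; rewrite mxE.
have -> : logp e = fun z : 'rV[R]_ne => \sum_i ln (pm e i (z 0 i)).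
  apply: funext => z'; rewrite /logp /= pe_prod ln_prod // => i.
  exact: pm_gt0.
by rewrite (derive_sum_coord (fun i y => ln (pm e i y))).
Qed.

Lemma ze_differentiable x : differentiable ze x.
Proof. exact: differentiable_comp (h_diff x) (differentiable_lsubmx _). Qed.

Lemma logp_ratio_ze e1 e2 x :
  (logp e1 - logp e2) (ze x) = ln (pe' e1 (lsubmx x) / pe' e2 (lsubmx x)).
Proof. by rewrite -density_ratio_lsubmx ln_div ?posrE. Qed.

Lemma diff_logp_ratio_stationary e1 e2 x v : lsubmx v = 0 ->
  'd (logp e1 - logp e2) (ze x) ('d ze x v) = 0.
Proof.
move=> v_l0.
have dlogp_ratio : differentiable (logp e1 - logp e2) (ze x).
  exact: differentiableB (logp_differentiable _ _) (logp_differentiable _ _).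
transitivity ('d ((logp e1 - logp e2) \o ze) x v).
  by rewrite (diff_comp (ze_differentiable x) dlogp_ratio).
rewrite -deriveE; last first.
  exact: differentiable_comp (ze_differentiable x) dlogp_ratio.
apply: derive_cst_along => t; rewrite /comp !logp_ratio_ze.
by rewrite linearD linearZ /= v_l0 scaler0 add0r.
Qed.

Lemma diff_ze_stationary x v : lsubmx v = 0 -> 'd ze x v = 0.
Proof.
move=> v_l0; have [es es_free] := w_free (ze x).
apply: row_free_mulmx_tr_eq0 es_free _; apply/rowP => j; rewrite !mxE.
rewrite -[RHS](diff_logp_ratio_stationary (es (lift ord0 j)) (es ord0) x v_l0).
rewrite (diffB (logp_differentiable _ _) (logp_differentiable _ _)) /=.
rewrite !diff_logp -sumrB.
by apply: eq_bigr => k _; rewrite !mxE mulrBr.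
Qed.

Lemma ze_lsubmx x : ze x = ze (row_mx (lsubmx x) 0).
Proof. exact: lsubmx_determines ze_differentiable diff_ze_stationary x. Qed.

End NonstationaryBlock.

Theorem theorem3p3 (R : realType) (ne ns E : nat)
  (* true model: p(z^e_t | e_t), its marginals p(z^e_{t,i} | e_t),
     and the (environment-free) density of the stationary part z^s_t *)
  (pe : 'I_E -> 'rV[R]_ne -> R) (pm : 'I_E -> 'I_ne -> R -> R)
  (ps : 'rV[R]_ns -> R)
  (* estimated model of the same form *)
  (pe' : 'I_E -> 'rV[R]_ne -> R) (pm' : 'I_E -> 'I_ne -> R -> R)
  (ps' : 'rV[R]_ns -> R)
  (* h = g^-1 \o ghat, z_t = h (zhat_t), with inverse hinv *)
  (h hinv : 'rV[R]_(ne + ns) -> 'rV[R]_(ne + ns)) :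
  (* A3.3.1: smooth and positive density p(z^e_t | e_t) *)
  (forall e, smooth (pe e)) ->
  (forall e ze, 0 < pe e ze) ->
  (* A3.3.2: conditional independence of the z^e_{t,i} given e_t *)
  (forall e i, density1 (pm e i)) ->
  (forall e ze, pe e ze = \prod_(i < ne) pm e i (ze 0 i)) ->
  (* stationary part: positive density over the latent space *)
  (forall zs, 0 < ps zs) ->
  (* estimated model has the same conditional-independence structure *)
  (forall e i, density1 (pm' e i)) ->
  (forall e ze, pe' e ze = \prod_(i < ne) pm' e i (ze 0 i)) ->
  (forall zs, 0 <= ps' zs) ->
  (* A3.3.3: linear independence *)
  (forall ze : 'rV[R]_ne, exists es : 'I_ne.+1 -> 'I_E,
      row_free (\matrix_(j < ne)
         (wvec pm ze (es (lift ord0 j)) - wvec pm ze (es ord0)))) ->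
  (* learning the data generation process: h is an invertible smooth map
     and the observational distributions match, i.e. the estimated latent
     density given e_t is the push-back of the true one along h *)
  cancel h hinv -> cancel hinv h -> smooth h -> smooth hinv ->
  (forall e zh,
     pe' e (lsubmx zh) * ps' (rsubmx zh) =
     pe e (lsubmx (h zh)) * ps (rsubmx (h zh)) * `|\det ('J h zh)|) ->
  (* conclusion: subspace identifiability of z^e_t *)
  forall i : 'I_ne, exists hi : 'rV[R]_ne -> R,
    forall zh : 'rV[R]_(ne + ns), lsubmx (h zh) 0 i = hi (lsubmx zh).
Proof.
move=> pe_smooth pe_gt0 pm_density pe_prod ps_gt0 _ _ _ w_free hK hinvK
  h_smooth hinv_smooth pushback i.
have pe_diff e z : differentiable (pe e) z := pe_smooth e [::] z.
have h_diff x : differentiable h x := h_smooth [::] x.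
have pm_ge0 e k y : 0 <= pm e k y by have [] := pm_density e k.
have det_J_neq0 := det_jacobian_neq0 hK hinvK h_diff (hinv_smooth [::]).
have ze_eq := ze_lsubmx pe_diff pe_gt0 pm_ge0 pe_prod ps_gt0 h_diff det_J_neq0
  pushback w_free.
exists (fun a => lsubmx (h (row_mx a 0)) 0 i) => zh.
by have /= -> := ze_eq zh.
Qed.
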